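(* Let $n\ge 1$ and let $A=\{a_1,\ldots,a_n\}$ be an alphabet of $n$ distinct nonzero elements of a field, with $A^{\vee}=\{a_1^{-1},\ldots,a_n^{-1}\}$. Let $J=(j_1,\ldots,j_n)\in\mathbb{Z}^n$ be weakly increasing, $j_1\le\cdots\le j_n$. Let $J_1=(j_1,\ldots,j_t)$ be its negative part (the entries $<0$) and $J_2=(j_{t+1},\ldots,j_n)$ its nonnegative part. Let $(\alpha|\beta)=(\alpha_1,\ldots,\alpha_{r_1}|\beta_1,\ldots,\beta_{r_1})$ be the Frobenius decomposition of the partition $-J_1^{\omega}=(-j_t,\ldots,-j_1)$, of rank $r_1$, and let $(\gamma|\delta)=(\gamma_1,\ldots,\gamma_{r_2}|\delta_1,\ldots,\delta_{r_2})$ be the Frobenius decomposition of the partition $J_2$, of rank $r_2$. Then $$\mathfrak{G}_J(A)=\det\begin{pmatrix}P&Q\\ M&N\end{pmatrix},$$ where $$P=\bigl(S_{\alpha_{r_1+1-j}\,\&\,\beta_{r_1+1-i}}(A^{\vee})\bigr)_{1\le i\le r_1,\,1\le j\le r_1},\qquad Q=\bigl(S_{\gamma_j\,\&\,(n-1-\beta_{r_1+1-i})}(A)\bigr)_{1\le i\le r_1,\,1\le j\le r_2},$$ $$M=\bigl(S_{\alpha_{r_1+1-j}\,\&\,(n-1-\delta_i)}(A^{\vee})\bigr)_{1\le i\le r_2,\,1\le j\le r_1},\qquad N=\bigl(S_{\gamma_j\,\&\,\delta_i}(A)\bigr)_{1\le i\le r_2,\,1\le j\le r_2}.$$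
   Context: For $J=(j_1,\ldots,j_n)\in\mathbb{Z}^n$, $$\mathfrak{G}_J(A)=\frac{\det\bigl(a_k^{\,j_l+l-1}\bigr)_{1\le l,k\le n}}{\det\bigl(a_k^{\,l-1}\bigr)_{1\le l,k\le n}}.$$ Partitions are written as nondecreasing sequences of nonnegative integers. For $i,j\in\mathbb{N}=\{0,1,2,\ldots\}$, $i\,\&\,j$ denotes the hook partition $(1^j,i+1)$, i.e. $j$ parts equal to $1$ followed by one part $i+1$. For a partition $I=(i_1,\ldots,i_p)$ and a finite alphabet $C$, $S_I(C)=\det\bigl(S_{i_k+k-l}(C)\bigr)_{1\le l,k\le p}$ is the usual Schur function, where $\sum_{k\ge0}S_k(C)z^k=\prod_{c\in C}(1-cz)^{-1}$ and $S_k(C)=0$ for $k<0$. Frobenius decomposition (into diagonal hooks): for a partition with parts listed in decreasing order $\lambda_1\ge\lambda_2\ge\cdots$ and conjugate partition $\lambda'$, the rank $r$ is the number of indices $i$ with $\lambda_i\ge i$, and the Frobenius decomposition is $(\alpha_1,\ldots,\alpha_r|\beta_1,\ldots,\beta_r)$ with $\alpha_i=\lambda_i-i$ and $\beta_i=\lambda'_i-i$ for $1\le i\le r$ (so both sequences are strictly decreasing). If a part of the block decomposition has rank $0$ the corresponding rows and columns are absent; the empty determinant is $1$. *)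

(* Defs.v *)
From mathcomp Require Import all_boot all_order all_algebra.

Set Implicit Arguments.
Unset Strict Implicit.
Unset Printing Implicit Defensive.

Import Order.TTheory GRing.Theory Num.Theory.
Local Open Scope ring_scope.

Section Functions.

Variables (K : comNzRingType) (n : nat).
Implicit Type C : 'I_n -> K.

(* S_k(C): the coefficient of z^k in the product over c of the geometric
   series 1 / (1 - c z), each of which may be truncated after degree k. *)
Definition complete C (k : int) : K :=
  if k is Posz m then (\prod_(i < n) \poly_(j < m.+1) C i ^+ j)`_m else 0.

Lemma coef_prod_eq (m : nat) (F G : 'I_n -> {poly K}) :
    (forall i k, (k <= m)%N -> (F i)`_k = (G i)`_k) ->
  forall k, (k <= m)%N -> (\prod_i F i)`_k = (\prod_i G i)`_k.
Proof.
move=> eqFG.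
pose R (p q : {poly K}) := forall k, (k <= m)%N -> p`_k = q`_k.
suff: R (\prod_i F i) (\prod_i G i) by [].
apply: (big_ind2 R) => [//|p p' q q' pp' qq' k lekm|i _]; last exact: eqFG.
rewrite !coefM; apply: eq_bigr => i _.
rewrite pp' ?qq' //; last by rewrite (leq_trans _ lekm) // -ltnS ltn_ord.
by rewrite (leq_trans (leq_subr _ _)).
Qed.

Lemma complete_gen C (m : nat) :
  \sum_(i < m.+1)
     (\prod_(l < n) (1 - C l *: 'X))`_i * complete C (m - i)%N%:Z = (m == 0%N)%:R.
Proof.
transitivity
  ((\prod_(l < n) (1 - C l *: 'X) * \prod_(l < n) \poly_(j < m.+1) C l ^+ j)`_m).
  rewrite coefM; apply: eq_bigr => i _; congr (_ * _).
  apply: coef_prod_eq (leqnn _) => l k lek.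
  rewrite !coef_poly ltnS lek ltnS.
  by rewrite (leq_trans lek (leq_subr _ _)).
rewrite -big_split /= (@coef_prod_eq m _ (fun=> 1)) //.
  by rewrite big1 // coef1.
move=> i k lekm; rewrite mulrBl mul1r -scalerAl coefB coefZ coefXM coef1.
case: k lekm => [|k] lekm /=; rewrite !coef_poly.
  by rewrite mulr0 subr0 expr0.
by rewrite ltnS lekm (leq_trans lekm (leqnSn _)) exprS subrr.
Qed.

Definition schur (I : seq nat) C : K :=
  \det (\matrix_(l < size I, k < size I)
          complete C (Posz (nth 0%N I k) + k%:Z - l%:Z)).

End Functions.

(* Partitions are nondecreasing sequences. *)
Definition hook (i j : nat) : seq nat := rcons (nseq j 1%N) i.+1.

(* Frobenius data, with 0-based indices: the largest part has index 0. The
   natural-number subtractions are exact for indices below the rank. *)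
Definition part (I : seq nat) (i : nat) : nat := nth 0%N (rev I) i.

Definition conj_part (I : seq nat) (i : nat) : nat := count (fun x => i < x)%N I.

Definition frob_rank (I : seq nat) : nat :=
  count (fun i => i < part I i)%N (iota 0 (size I)).

Definition frob_arm (I : seq nat) (i : nat) : nat := (part I i - i.+1)%N.

Definition frob_leg (I : seq nat) (i : nat) : nat := (conj_part I i - i.+1)%N.

Definition alternant (K : fieldType) (n : nat) (J : 'I_n -> int) (A : 'I_n -> K) : K :=
  \det (\matrix_(l < n, k < n) A k ^ (J l + l%:Z))
  / \det (\matrix_(l < n, k < n) A k ^+ l).

(* (- j_t, ..., - j_1), for j_1 <= ... <= j_t the negative entries of J. *)
Definition neg_partition (n : nat) (J : 'I_n -> int) : seq nat :=
  rev [seq `|J l|%N | l <- enum 'I_n & J l < 0].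

Definition nonneg_partition (n : nat) (J : 'I_n -> int) : seq nat :=
  [seq `|J l|%N | l <- enum 'I_n & 0 <= J l].

(* Main.v *)
Require Import Defs.
From mathcomp Require Import all_boot all_order all_fingroup all_algebra.
From mathcomp Require Import zify.

Set Implicit Arguments.
Unset Strict Implicit.
Unset Printing Implicit Defensive.

Import Order.TTheory GRing.Theory Num.Theory.
Local Open Scope ring_scope.

(** Write v_k for the row (a_1^k, ..., a_n^k), k in Z.  The rows v_0, ..., v_(n-1)
    form a basis, and the alternant of J is the determinant of the coordinates of
    the rows v_(e_l), where e_l = j_l + l for 0 <= l < n.  Most of these
    coordinates are trivial: if 0 <= e_l < n, then v_(e_l) is itself a basis row.
    The other exponents are governed by the Frobenius decompositions:

    - e_l < 0 exactly when l is smaller than the rank of the negative partition,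
      and then e_l = - (alpha_l + 1);
    - e_(n-1-l) >= n exactly when l is smaller than the rank of the nonnegative
      partition, and then e_(n-1-l) = n + gamma_l.

    The coordinates of v_(n+g) and v_(-g-1) on the basis are hook Schur
    functions up to sign (power_expansion_pos, power_expansion_neg); this follows
    by induction on g from a formula for a hook Schur function as a truncated
    convolution of complete and elementary symmetric functions (schur_hook).

    The basis rows that do not occur among the v_(e_l) have the indices beta_i and
    n-1-delta_i, so only the minor on these columns survives (det_replace_rows):
    it is the block determinant, up to the sign of a permutation and the signs of
    the coordinates.  The permutation sends l to e_l when e_l is in [0, n), and
    pairs the rows of the remaining exponents with the missing columns.  It
    preserves the negative and the nonnegative positions separately, and on each
    side its sign is (-1) to the sum of the legs (frob_perm), which is what the
    signs of the coordinates contribute too. *)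

(** * Hook Schur functions as truncated convolutions *)

Section HookSchur.

Variables (K : comNzRingType) (n : nat) (C : 'I_n -> K).

Definition signed_elem (l : nat) : K := (\prod_(i < n) (1 - C i *: 'X))`_l.

(** The full sum, over l <= k + j, is a coefficient of the product of the two
    mutually inverse generating series, hence 0 for k + j > 0; cut after l = j it
    is, up to sign, the Schur function of the hook with arm k - 1 and leg j. *)
Definition truncated_conv (k j : nat) : K :=
  \sum_(l < j.+1) signed_elem l * complete C (k + j - l)%N%:Z.

Lemma signed_elem0 : signed_elem 0 = 1.
Proof.
rewrite /signed_elem -horner_coef0 horner_prod big1 // => i _.
by rewrite !hornerE subr0.
Qed.

Lemma signed_elem_gt l : (n < l)%N -> signed_elem l = 0.
Proof.
move=> lt_nl; apply: nth_default; apply: leq_trans lt_nl.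
apply: leq_trans (size_prod_leq _ _) _; rewrite /= card_ord leq_subLR.
rewrite addnS ltnS; apply: (@leq_trans (\sum_(i < n) 2)); last first.
  by rewrite sum_nat_const card_ord; lia.
apply: leq_sum => i _.
apply: leq_trans (size_polyD _ _) _.
rewrite size_polyN size_poly1 geq_max /=.
by rewrite (leq_trans (size_scale_leq _ _)) ?size_polyX.
Qed.

Lemma truncated_conv0 j : truncated_conv 0 j = (j == 0%N)%:R.
Proof. exact: complete_gen. Qed.

Lemma complete0 : complete C 0 = 1.
Proof.
have:= truncated_conv0 0.
by rewrite /truncated_conv big_ord1 signed_elem0 mul1r.
Qed.

Lemma truncated_convS k j :
  truncated_conv k.+1 j =
    truncated_conv k j.+1 - signed_elem j.+1 * complete C k%:Z.
Proof.
rewrite /truncated_conv [in RHS]big_ord_recr /= addnK addrK.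
by apply: eq_bigr => l _; rewrite addSnnS.
Qed.

(** The elementary symmetric functions vanish beyond degree n, so that for j = n
    nothing has been cut off. *)
Lemma truncated_conv_size k : (0 < k)%N -> truncated_conv k n = 0.
Proof.
move=> k_gt0; have:= complete_gen C (k + n).
rewrite (_ : (_ == 0%N) = false) /=; last lia.
rewrite (_ : (k + n).+1 = n.+1 + k)%N; last lia.
rewrite big_split_ord /= [X in _ + X]big1 ?addr0 // => i _.
by rewrite -/(signed_elem _) signed_elem_gt ?mul0r //; lia.
Qed.

Lemma complete_lt0 k : k < 0 -> complete C k = 0.
Proof. by case: k. Qed.

Lemma schur_size (m : nat) (I : seq nat) : size I = m ->
  schur I C =
    \det (\matrix_(l < m, k < m) complete C (Posz (nth 0%N I k) + k%:Z - l%:Z)).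
Proof. by move=> <-. Qed.

(** In the Jacobi-Trudi matrix of a hook, row l of column k < j is S_(1 + k - l).
    Replacing the top row by the combination of all rows with coefficients
    signed_elem, the first of which is 1, turns this column's top entry into the
    coefficient of degree k + 1 in a product of inverse series, that is 0.  Only
    the last entry of the top row survives, and its minor is unitriangular. *)
Lemma schur_hook g j : schur (hook g j) C = (-1) ^+ j * truncated_conv g.+1 j.
Proof.
rewrite (@schur_size j.+1); last by rewrite size_rcons size_nseq.
set H := \matrix_(l, k) _.
pose u : 'rV[K]_j.+1 := \row_l signed_elem l.
pose U : 'M[K]_(1 + j) := block_mx 1%:M (rsubmx (u : 'rV_(1 + j))) 0 1%:M.
have detU : \det U = 1 by rewrite det_ublock !det1 mulr1.
have U0 k : (U *m H) ord0 k = if (k < j)%N then 0 else truncated_conv g.+1 j.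
  rewrite mxE (eq_bigr (fun l : 'I_j.+1 => signed_elem l * H l k)); last first.
    move=> l _; congr (_ * _); rewrite -[ord0](lshift0 _ 0).
    case: (@split_ordP 1 j l) => l' ->.
      by rewrite block_mxEul !ord1 mxE eqxx signed_elem0.
    by rewrite block_mxEur !mxE.
  case: ifPn => [lt_kj|]; last first.
    rewrite -leqNgt => le_jk; have def_k : k = j :> nat by have:= ltn_ord k; lia.
    apply: eq_bigr => l _; rewrite mxE def_k nth_rcons size_nseq ltnn eqxx.
    by congr (_ * complete C _); have:= ltn_ord l; lia.
  rewrite -[RHS](complete_gen C k.+1).
  pose F l := signed_elem l * complete C (k.+1 - l)%N%:Z.
  rewrite [RHS](big_ord_widen j.+1 F) //.
  rewrite [RHS]big_mkcond; apply: eq_bigr => l _.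
  rewrite mxE nth_rcons size_nseq lt_kj nth_nseq lt_kj.
  case: ifPn => [lt_lk|].
    by congr (_ * complete C _); lia.
  move=> ge_lk; rewrite complete_lt0 ?mulr0 //.
  by lia.
have US (l : 'I_j) k : (U *m H) (lift ord0 l) k = H (lift ord0 l) k.
  rewrite mxE (bigD1 (lift ord0 l)) //=.
  have -> : lift ord0 l = rshift 1 l by apply: val_inj.
  rewrite block_mxEdr mxE eqxx mul1r big1 ?addr0 // => i.
  case: (@split_ordP 1 j i) => i' -> neq_i.
    by rewrite block_mxEdl mxE mul0r.
  rewrite block_mxEdr mxE; case: eqP => [eq_i|]; last by rewrite mul0r.
  by rewrite eq_i eqxx in neq_i.
have -> : \det H = \det (U *m H) by rewrite det_mulmx detU mul1r.
rewrite (expand_det_row _ ord0) big_ord_recr /=.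
rewrite big1 ?add0r => [|k _]; last by rewrite U0 /= ltn_ord mul0r.
rewrite U0 ltnn mulrC; congr (_ * _).
rewrite /cofactor add0n -[RHS]mulr1; congr (_ * _).
rewrite -det_tr det_trig.
  apply: big1 => i _; rewrite mxE [LHS]mxE [LHS]mxE US mxE.
  rewrite lift_max nth_rcons size_nseq ltn_ord nth_nseq ltn_ord lift0.
  by rewrite -[RHS]complete0; congr complete; lia.
apply/is_trig_mxP => i k lt_ik; rewrite mxE [LHS]mxE [LHS]mxE US mxE.
rewrite lift_max nth_rcons size_nseq ltn_ord nth_nseq ltn_ord lift0.
by rewrite complete_lt0 // subr_lt0 -PoszD ltz_nat.
Qed.

End HookSchur.

(** * Powers of a letter modulo the characteristic polynomial *)

Section PowerExpansion.

Variables (K : fieldType) (n : nat) (A : 'I_n -> K).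
Hypothesis A_neq0 : forall k, A k != 0.

Lemma signed_elem_root k : \sum_(i < n.+1) signed_elem A (n - i) * A k ^+ i = 0.
Proof.
pose p : {poly K} := \prod_(i < n) (1 - A i *: 'X).
have rootp : p.[(A k)^-1] = 0.
  by rewrite horner_prod (bigD1 k) //= !hornerE mulfV // subrr mul0r.
have sz_p : (size p <= n.+1)%N by apply/leq_sizeP => l /(signed_elem_gt A).
transitivity (p.[(A k)^-1] * A k ^+ n); last by rewrite rootp mul0r.
rewrite (horner_coef_wide _ sz_p) big_distrl /= (reindex_inj rev_ord_inj) /=.
apply: eq_bigr => i _; have le_in : (i <= n)%N by rewrite -ltnS.
rewrite subSS subKn // -mulrA; congr (_ * _).
have -> : A k ^+ n = A k ^+ i * A k ^+ (n - i) by rewrite -exprD subnKC.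
rewrite exprVn mulrA mulVf ?mul1r //.
by rewrite expf_neq0.
Qed.

(** Multiplying the expansion for g by the letter produces one power too many,
    which signed_elem_root reduces; the resulting recurrence on the coefficients
    is truncated_convS. *)
Lemma power_expansion g k : (0 < n)%N ->
  A k ^+ (n.-1 + g) = \sum_(i < n) truncated_conv A g (n.-1 - i) * A k ^+ i.
Proof.
move=> n_gt0; elim: g => [|g IHg].
  rewrite (bigD1 (Ordinal (ltac:(lia) : n.-1 < n)%N)) //= subnn.
  rewrite truncated_conv0 mul1r addn0.
  rewrite big1 ?addr0 // => i; rewrite -val_eqE /= => neq_i.
  rewrite truncated_conv0 (_ : _ == _ = false) ?mul0r //.
  by have:= ltn_ord i; lia.
pose F i := truncated_conv A g (n - i) * A k ^+ i.
rewrite addnS exprSr IHg big_distrl /=.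
transitivity (\sum_(i < n) F i.+1).
  apply: eq_bigr => i _; rewrite /F -mulrA -exprSr; congr (truncated_conv _ _ _ * _).
  by lia.
(* The constant term: a coefficient with nothing cut off. *)
have F0 : F 0%N = 0.
  rewrite /F subn0 expr0 mulr1; case: (g) => [|g']; last exact: truncated_conv_size.
  by rewrite truncated_conv0 eqn0Ngt n_gt0.
have Fn : F n = complete A g%:Z * A k ^+ n.
  by rewrite /F subnn /truncated_conv big_ord1 signed_elem0 mul1r addn0 subn0.
have -> : \sum_(i < n) F i.+1 = \sum_(i < n.+1) F i.
  by rewrite [RHS]big_ord_recl F0 add0r.
have := signed_elem_root k; rewrite !big_ord_recr /= subnn signed_elem0 mul1r.
move/eqP; rewrite addrC addr_eq0 => /eqP def_An; rewrite Fn def_An mulrN mulr_sumr.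
rewrite -sumrB; apply: eq_bigr => i _.
have lt_in := ltn_ord i.
rewrite truncated_convS mulrBl /F (_ : (n.-1 - i).+1 = n - i)%N; last lia.
by congr (_ - _); rewrite mulrA [complete _ _ * _]mulrC.
Qed.

Lemma power_expansion_pos g k : (0 < n)%N ->
  A k ^ (n + g)%N%:Z =
    \sum_(i < n) (-1) ^+ (n.-1 - i) * schur (hook g (n.-1 - i)) A * A k ^+ i.
Proof.
move=> n_gt0; rewrite -exprnP (_ : (n + g = n.-1 + g.+1)%N); last lia.
rewrite power_expansion //; apply: eq_bigr => i _.
by rewrite schur_hook signrMK.
Qed.

End PowerExpansion.

(** This is power_expansion_pos for the inverse letters, multiplied by the power
    n - 1 of the letter. *)
Lemma power_expansion_neg (K : fieldType) n (A : 'I_n -> K) g k :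
    (forall k, A k != 0) -> (0 < n)%N ->
  A k ^ (- g.+1%:Z) =
    \sum_(i < n) (-1) ^+ i * schur (hook g i) (fun k => (A k)^-1) * A k ^+ i.
Proof.
move=> A_neq0 n_gt0.
pose A_vee k := (A k)^-1; have Av_neq0 i : A_vee i != 0 by rewrite invr_eq0.
transitivity (A_vee k ^ (n + g)%N%:Z * A k ^+ n.-1).
  rewrite -exprnP -exprnN (_ : (n + g = g.+1 + n.-1)%N); last lia.
  by rewrite exprD exprVn -mulrA -exprMn mulVf // expr1n mulr1.
rewrite (power_expansion_pos Av_neq0) // big_distrl (reindex_inj rev_ord_inj) /=.
apply: eq_bigr => i _; have lt_in := ltn_ord i.
rewrite (_ : n.-1 - (n - i.+1) = i)%N; last lia.
rewrite -!mulrA; congr (_ * (_ * _)).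
rewrite (_ : n.-1 = n - i.+1 + i)%N; last lia.
by rewrite exprD mulrA -exprMn mulVf // expr1n mul1r.
Qed.

Lemma det_power_neq0 (K : fieldType) n (A : 'I_n -> K) : injective A ->
  \det (\matrix_(l < n, k < n) A k ^+ l) != 0.
Proof.
move=> A_inj; have -> : \matrix_(l, k) A k ^+ l = Vandermonde n (\row_k A k).
  by apply/matrixP => l k; rewrite !mxE.
rewrite det_Vandermonde; apply/prodf_neq0 => i _; apply/prodf_neq0 => k lt_ik.
by rewrite !mxE subr_eq0 (inj_eq A_inj) -val_eqE /= gtn_eqF.
Qed.

(** * Determinants with prescribed rows *)

Section Determinants.

Variable R : comPzRingType.

(** Both sides are the determinant of the block matrix with rows (1, -U) and
    (V, 1), eliminated from either end. *)
Lemma det_add1_mulmxC n r (U : 'M[R]_(n, r)) (V : 'M_(r, n)) :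
  \det (1%:M + U *m V) = \det (1%:M + V *m U).
Proof.
have detB : \det (block_mx 1%:M (- U) V 1%:M) = \det (1%:M + U *m V).
  have -> : block_mx 1%:M (- U) V 1%:M =
      block_mx (1%:M + U *m V) (- U) 0 1%:M *m block_mx 1%:M 0 V 1%:M.
    by rewrite mulmx_block !mulmx1 !mul1mx !mul0mx mulNmx mulmx0 !add0r addrK.
  by rewrite det_mulmx det_ublock det_lblock !det1 !mulr1.
rewrite -detB.
have -> : block_mx 1%:M (- U) V 1%:M =
    block_mx 1%:M 0 V 1%:M *m block_mx 1%:M (- U) 0 (1%:M + V *m U).
  by rewrite mulmx_block !mulmx1 !mul1mx !mul0mx mulmxN !addr0 addrCA addNr addr0.
by rewrite det_mulmx det_ublock det_lblock !det1 !mul1r.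
Qed.

(** A matrix whose rows are rows of W, apart from r of them that are combinations
    of rows of W.  After permuting W, it differs from W by a factor
    1 + U V where U has r columns, and exchanging U and V leaves a determinant of
    size r. *)
Lemma det_replace_rows n r (s : 'S_n) (a : 'I_r -> 'I_n)
    (C : 'M[R]_(r, n)) (E W : 'M_n) :
  injective a ->
  (forall i, row (a i) E = row i (C *m W)) ->
  (forall l, l \notin codom a -> row l E = row (s l) W) ->
  \det E = (-1) ^+ s * \det (\matrix_(i, j) C i (s (a j))) * \det W.
Proof.
move=> a_inj Ea El; pose U : 'M[R]_(n, r) := \matrix_(l, i) (l == a i)%:R.
have U_row p (X : 'M_(r, p)) i : row (a i) (U *m X) = row i X.
  apply/rowP => k; rewrite !mxE (bigD1 i) //= mxE eqxx mul1r big1 ?addr0 //.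
  by move=> j ne_ji; rewrite mxE (inj_eq a_inj) eq_sym (negbTE ne_ji) mul0r.
have Ut_row p (X : 'M_(n, p)) i : row i (U^T *m X) = row (a i) X.
  apply/rowP => k; rewrite !mxE (bigD1 (a i)) //= !mxE eqxx mul1r big1 ?addr0 //.
  by move=> l ne_l; rewrite !mxE (negbTE ne_l) mul0r.
pose W' := row_perm s W; pose C' := col_perm s C.
have CW : C *m W = C' *m W'.
  apply/matrixP => i k; rewrite !mxE (reindex_inj (@perm_inj _ s)) /=.
  by apply: eq_bigr => l _; rewrite !mxE.
pose V := C' - U^T.
have defE : E = (1%:M + U *m V) *m W'.
  apply/row_matrixP => l; rewrite mulmxDl mul1mx -mulmxA raddfD /=.
  have [/codomP[i ->]|l_a] := boolP (l \in codom a).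
    rewrite Ea U_row CW mulmxBl raddfB /= Ut_row addrC.
    by rewrite subrK.
  rewrite El // -[LHS]addr0; congr (_ + _); apply/rowP => k.
    by rewrite !mxE.
  rewrite !mxE big1 // => i _; rewrite mxE; case: eqP => [l_ai|]; last by rewrite mul0r.
  by rewrite l_ai codom_f in l_a.
have defC : 1%:M + V *m U = \matrix_(i, j) C i (s (a j)).
  have UtU : U^T *m U = 1%:M.
    by apply/row_matrixP => i; rewrite Ut_row -{1}[U]mulmx1 U_row.
  rewrite mulmxBl UtU addrC subrK; apply/matrixP => i j.
  rewrite !mxE (bigD1 (a j)) //= !mxE eqxx mulr1 big1 ?addr0 // => l ne_l.
  by rewrite !mxE (negbTE ne_l) mulr0.
rewrite defE det_mulmx det_add1_mulmxC defC /W' row_permE det_mulmx det_perm.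
by rewrite mulrA [_ * (-1) ^+ _]mulrC.
Qed.

Lemma det_scale_rows_cols n (x y : 'I_n -> R) (M : 'M_n) :
  \det (\matrix_(i, j) (x i * M i j * y j)) =
    (\prod_i x i) * (\prod_i y i) * \det M.
Proof.
have -> : \matrix_(i, j) (x i * M i j * y j) =
    diag_mx (\row_i x i) *m (M *m diag_mx (\row_i y i)).
  rewrite mul_mx_diag mul_diag_mx; apply/matrixP => i j.
  by rewrite !mxE mulrA.
rewrite !det_mulmx !det_diag mulrA mulrAC.
by congr (_ * _ * _); apply: eq_bigr => i _; rewrite mxE.
Qed.

End Determinants.

(** * The permutation of a Frobenius decomposition *)

Lemma count_downset (P : pred nat) n i :
    (forall k l, (k <= l)%N -> P l -> P k) ->
  (i < count P (iota 0 n))%N = (i < n)%N && P i.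
Proof.
move=> downP; elim: n => [|n IHn] //.
rewrite -(addn1 n) iotaD count_cat /= add0n addn0.
case: (boolP (P n)) => Pn /=; last first.
  rewrite addn0 IHn addn1 ltnS [in RHS]leq_eqVlt.
  by case: (i =P n) => [->|] //=; rewrite ltnn (negbTE Pn).
have -> : count P (iota 0 n) = n.
  rewrite -[RHS](size_iota 0); apply/eqP; rewrite -all_count; apply/allP => k.
  by rewrite mem_iota => /andP[_ /ltnW le_kn]; apply: downP Pn.
rewrite addn1 ltnS; case: leqP => //= le_in.
by apply/esym/(downP _ n).
Qed.

Section Frobenius.

Variable I : seq nat.
Hypothesis I_sorted : sorted leq I.

Lemma part_default l : (size I <= l)%N -> part I l = 0%N.
Proof. by move=> le_Il; rewrite /part nth_default // size_rev. Qed.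

Lemma part_decr k l : (k <= l)%N -> (part I l <= part I k)%N.
Proof.
move=> le_kl; have [/part_default -> //|lt_lI] := leqP (size I) l.
rewrite /part !nth_rev //; last exact: leq_ltn_trans lt_lI.
by apply: (sorted_leq_nth leq_trans leqnn 0%N I_sorted); rewrite ?inE; lia.
Qed.

Lemma ltn_frob_rank i : (i < frob_rank I)%N = (i < part I i)%N.
Proof.
rewrite count_downset; last first.
  by move=> k l le_kl /(leq_ltn_trans le_kl) /leq_trans; apply; exact: part_decr.
by case: ltnP => //= /part_default ->.
Qed.

Lemma frob_rank_size : (frob_rank I <= size I)%N.
Proof. by rewrite -[X in (_ <= X)%N](size_iota 0) count_size. Qed.

End Frobenius.

(** Beyond the rank, the numbers l - part I l are the indices below t that are
    not legs, so that the formula defines a permutation.  By induction on t: a zero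
    part adds a fixed last point; when all parts are positive, the leg of the
    first diagonal hook is t - 1, and peeling off this hook lowers the remaining
    parts by one, so the permutation is that of the smaller partition, extended
    by 0 |-> t - 1, which contributes t - 1 inversions. *)
Lemma frob_perm t (I : seq nat) : size I = t -> sorted leq I ->
  exists s : 'S_t,
    (forall l, s l = (if l < part I l then frob_leg I l else l - part I l)%N :> nat)
    /\ s = odd (\sum_(i < frob_rank I) frob_leg I i) :> bool.
Proof.
elim: t I => [|t IHt] I szI sI.
  exists 1%g; split; first by case.
  by rewrite odd_perm1 big1 // => -[i lt_i _]; have:= frob_rank_size I; lia.
have [I0|I_gt0] := boolP (0%N \in I).
  case: I I0 szI sI => [|x I'] //= I0 [szI] sI.
  have {I0} x0 : x = 0%N.
    move: I0; rewrite inE => /orP[/eqP //|I0].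
    have /allP/(_ _ I0) := order_path_min leq_trans sI.
    by rewrite leqn0 => /eqP.
  subst x; have sI' := path_sorted sI.
  have [s [sE s_odd]] := IHt _ szI sI'.
  have partE l : part (0%N :: I') l = part I' l.
    rewrite /part rev_cons nth_rcons; case: ltnP => // le_l.
    by rewrite [RHS]nth_default // if_same.
  exists (lift_perm ord_max ord_max s); split=> [l|].
    case: (unliftP ord_max l) => [l'|] ->.
      by rewrite lift_perm_lift !lift_max partE sE.
    by rewrite lift_perm_id partE part_default ?szI // subn0.
  rewrite odd_lift_perm addbb addFb s_odd.
  have -> // : frob_rank (0%N :: I') = frob_rank I'.
  rewrite /frob_rank [size _]/= szI -addn1 iotaD count_cat /= partE.
  rewrite add0n part_default ?szI // !addn0; apply: eq_count => i.
  by rewrite partE.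
(* The parts are nondecreasing, so the first row of the diagram is the last part. *)
case/lastP: I szI sI I_gt0 => [|I0 x] //.
rewrite size_rcons mem_rcons inE negb_or eq_sym -lt0n => -[szI] sI /andP[x_gt0 I_gt0].
have I0_le y : y \in I0 -> (0 < y <= x)%N.
  move=> y_I0; apply/andP; split.
    by rewrite lt0n; apply: contraNneq I_gt0 => <-.
  move: sI; rewrite -rev_sorted rev_rcons => /(order_path_min (rev_trans leq_trans)).
  by move/allP/(_ y); rewrite mem_rev => /(_ y_I0).
have sI0 : sorted leq I0.
  by move: sI; rewrite -cats1 => /cat_sorted2[].
pose I' := [seq y.-1 | y <- I0].
have [||s [sE s_odd]] := IHt I'.
- by rewrite size_map.
- rewrite sorted_map; apply: sub_sorted sI0 => y z /=; lia.
have partS l : (l < t)%N -> part (rcons I0 x) l.+1 = (part I' l).+1.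
  move=> lt_lt; rewrite /part rev_rcons /= -map_rev (nth_map 0%N) ?size_rev ?szI //.
  rewrite prednK //; have /I0_le/andP[] // : nth 0%N (rev I0) l \in I0.
  by rewrite -mem_rev mem_nth // size_rev szI.
have part0 : part (rcons I0 x) 0 = x by rewrite /part rev_rcons.
have legS l : (l < part I' l)%N -> frob_leg (rcons I0 x) l.+1 = frob_leg I' l.
  move=> lt_l; rewrite /frob_leg /conj_part count_map -cats1 count_cat /=.
  have lt_lx : (l.+1 < x)%N.
    have lt_lt : (l < t)%N.
      by move: lt_l; case: (ltnP l t) => // le_tl; rewrite part_default ?size_map ?szI.
    have := part_decr sI (leq0n l.+1); rewrite part0 partS //; lia.
  rewrite lt_lx addn0 addn1 subSS; congr (_ - _)%N; apply: eq_count => y /=; lia.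
have rankS : frob_rank (rcons I0 x) = (frob_rank I').+1.
  rewrite /frob_rank size_rcons szI /= part0 x_gt0 add1n size_map szI; congr _.+1.
  rewrite -[1%N]addn0 iotaDl count_map; apply: eq_in_count => l.
  by rewrite mem_iota add0n /= => lt_lt; rewrite add1n partS.
have leg0 : frob_leg (rcons I0 x) 0 = t.
  rewrite /frob_leg /conj_part -cats1 count_cat /= x_gt0 addn1 subn1 /= -[RHS]szI.
  by apply/eqP; rewrite -all_count; apply/allP => y /I0_le/andP[].
exists (lift_perm ord0 ord_max s); split=> [l|].
  case: (unliftP ord0 l) => [l'|] ->; last first.
    by rewrite lift_perm_id part0 x_gt0 leg0.
  rewrite lift_perm_lift lift_max lift0 partS // ltnS sE subSS.
  by case: ifP => // /legS ->.
rewrite odd_lift_perm addFb s_odd rankS big_ord_recl oddD leg0; congr (_ (+) odd _).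
apply: eq_bigr => i _; rewrite lift0 legS // -ltn_frob_rank //.
by rewrite sorted_map; apply: sub_sorted sI0 => y z /=; lia.
Qed.

(** The sign is read off the block diagonal permutation matrix. *)
Lemma block_perm t u (s1 : 'S_t) (s2 : 'S_u) : exists s : 'S_(t + u),
  [/\ forall i, s (lshift u i) = lshift u (s1 i),
      forall i, s (rshift t i) = rshift t (s2 i)
    & s = s1 (+) s2 :> bool].
Proof.
pose f x : 'I_(t + u) :=
  match split x with inl i => lshift u (s1 i) | inr i => rshift t (s2 i) end.
have fl i : f (lshift u i) = lshift u (s1 i).
  by rewrite /f (unsplitK (inl i)).
have fr i : f (rshift t i) = rshift t (s2 i).
  by rewrite /f (unsplitK (inr i)).
have f_inj : injective f.
  move=> x y; case: (split_ordP x) => i ->; case: (split_ordP y) => k ->.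
  - by rewrite !fl => /lshift_inj/perm_inj ->.
  - by rewrite fl fr => /eqP; rewrite eq_lrshift.
  - by rewrite fl fr => /eqP; rewrite eq_rlshift.
  - by rewrite !fr => /rshift_inj/perm_inj ->.
exists (perm f_inj); split=> [i|i|]; rewrite ?permE //.
apply: (@signr_inj int); rewrite signr_addb -!det_perm -(@det_ublock _ _ _ _ 0).
congr (\det _); apply/matrixP => x y; rewrite mxE permE.
case: (split_ordP x) => i ->; case: (split_ordP y) => k ->.
- by rewrite block_mxEul fl !mxE eq_lshift.
- by rewrite block_mxEur fl !mxE eq_lrshift.
- by rewrite block_mxEdl fr !mxE eq_rlshift.
- by rewrite block_mxEdr fr !mxE eq_rshift.
Qed.

Lemma rev_ord_perm u (s : 'S_u) :
  exists2 s' : 'S_u, forall i, s' (rev_ord i) = rev_ord (s i) & s' = s :> bool.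
Proof.
pose w := perm (@rev_ord_inj u).
exists (s ^ w)%g; last exact: odd_permJ.
by move=> i; have := permJ s w i; rewrite !permE.
Qed.

(** * The block determinant *)

Section Blocks.

Variables (K : fieldType) (t u : nat) (A : 'I_(t + u) -> K) (J : 'I_(t + u) -> int).
Variables I1 I2 : seq nat.
Hypotheses (n_gt0 : (0 < t + u)%N) (A_inj : injective A) (A_neq0 : forall k, A k != 0).
Hypotheses (szI1 : size I1 = t) (szI2 : size I2 = u).
Hypotheses (sI1 : sorted leq I1) (sI2 : sorted leq I2).
Hypothesis JI1 : forall l : 'I_t, J (lshift u l) = - (part I1 l)%:Z.
Hypothesis JI2 : forall l : 'I_u, J (rshift t (rev_ord l)) = (part I2 l)%:Z.

Let n := (t + u)%N.
Let A_vee := fun k => (A k)^-1.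
Let r1 := frob_rank I1.
Let r2 := frob_rank I2.
Let beta (i : 'I_r1) := frob_leg I1 (rev_ord i).
Let delta (i : 'I_r2) := frob_leg I2 i.
Let alpha (i : 'I_r1) := frob_arm I1 (rev_ord i).
Let gamma (i : 'I_r2) := frob_arm I2 i.

(** The formula for an exponent vector split into its t negative and u nonnegative
    entries.  The rows of the alternant with exponent outside [0, n) are the first
    r1 and the last r2 ones.  In each group they are listed from bottom to top (by
    a in the proof), since this makes the matching columns beta and n - 1 - delta
    increase, as in the block matrix. *)
Lemma alternant_block_hooks :
  alternant J A = \det (block_mx
    (\matrix_(i < r1, j < r1) schur (hook (alpha j) (beta i)) A_vee)
    (\matrix_(i < r1, j < r2) schur (hook (gamma j) (n - 1 - beta i)) A)
    (\matrix_(i < r2, j < r1) schur (hook (alpha j) (n - 1 - delta i)) A_vee)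
    (\matrix_(i < r2, j < r2) schur (hook (gamma j) (delta i)) A)).
Proof.
have eq_u m : (m < u)%N -> (t + (u - m.+1) = t + u - 1 - m)%N by lia.
have exp_neg p l : (l < p)%N -> - p%:Z + l%:Z = - (p - l.+1).+1%:Z by lia.
have exp_pos p l : (l < p)%N -> (l < u)%N ->
    p%:Z + (t + (u - l.+1))%N%:Z = (t + u + (p - l.+1))%N%:Z by lia.
have exp_mid1 p l : (p <= l)%N -> - p%:Z + l%:Z = (l - p)%N%:Z by lia.
have exp_mid2 p l : (p <= l)%N -> (l < u)%N ->
    p%:Z + (t + (u - l.+1))%N%:Z = (t + (u - (l - p).+1))%N%:Z by lia.
have sign_sub m : (m < n)%N -> (-1) ^+ (n.-1 - m) = (-1) ^+ m * (-1) ^+ n.-1 :> K.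
  move=> lt_mn; rewrite -signr_odd oddB; last lia.
  by rewrite signr_addb !signr_odd mulrC.
have nE m : (n.-1 - m = n - 1 - m)%N by lia.
have le_un m : (m < u)%N -> (m < n)%N by rewrite /n; lia.
have subsubK m : (m < u)%N -> (n - 1 - (n - 1 - m) = m)%N by rewrite /n; lia.
set T := block_mx _ _ _ _.
rewrite /alternant -/n; set E := \matrix_(l, k) _; set W := \matrix_(l, k) _.
have [s1 [s1E s1_odd]] := frob_perm szI1 sI1.
have [s2 [s2E s2_odd]] := frob_perm szI2 sI2.
have [s2' s2'E s2'_odd] := rev_ord_perm s2.
have [s [sl sr s_odd]] := block_perm s1 s2'.
have le_r1 : (r1 <= t)%N by rewrite -szI1 frob_rank_size.
have le_r2 : (r2 <= u)%N by rewrite -szI2 frob_rank_size.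
pose a1 (i : 'I_r1) := widen_ord le_r1 (rev_ord i).
pose a2 (i : 'I_r2) := widen_ord le_r2 i.
pose a (x : 'I_(r1 + r2)) : 'I_n :=
  match split x with inl i => lshift u (a1 i) | inr i => rshift t (rev_ord (a2 i)) end.
have al i : a (lshift r2 i) = lshift u (a1 i) by rewrite /a (unsplitK (inl i)).
have ar i : a (rshift r1 i) = rshift t (rev_ord (a2 i)).
  by rewrite /a (unsplitK (inr i)).
have a1_part i : (a1 i < part I1 (a1 i))%N.
  by rewrite -ltn_frob_rank //= (ltn_ord (rev_ord i)).
have a2_part i : (a2 i < part I2 (a2 i))%N by rewrite -ltn_frob_rank //=.
have a_inj : injective a.
  move=> x y; case: (split_ordP x) => i ->; case: (split_ordP y) => k ->.
  - rewrite !al => /lshift_inj/(congr1 val)/= eq_ik; congr lshift.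
    by apply/rev_ord_inj/val_inj.
  - by rewrite al ar => /eqP; rewrite eq_lrshift.
  - by rewrite al ar => /eqP; rewrite eq_rlshift.
  - rewrite !ar => /rshift_inj/rev_ord_inj/(congr1 val)/= eq_ik; congr rshift.
    exact/val_inj.
have lt_delta i : (delta i < u)%N.
  by have := ltn_ord (s2 (a2 i)); rewrite s2E a2_part.
have sal i : s (a (lshift r2 i)) = beta i :> nat.
  by rewrite al sl /= s1E a1_part.
have sar i : s (a (rshift r1 i)) = (n - 1 - delta i)%N :> nat.
  rewrite ar sr s2'E /= s2E a2_part /=.
  exact/eq_u/lt_delta.
pose C : 'M[K]_(r1 + r2, n) := \matrix_(x, m)
  match split x with
  | inl i => (-1) ^+ m * schur (hook (alpha i) m) A_vee
  | inr i => (-1) ^+ (n.-1 - m) * schur (hook (gamma i) (n.-1 - m)) A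
  end.
have Cl i m : C (lshift r2 i) m = (-1) ^+ m * schur (hook (alpha i) m) A_vee.
  by rewrite mxE (unsplitK (inl i)).
have Cr i m : C (rshift r1 i) m =
    (-1) ^+ (n.-1 - m) * schur (hook (gamma i) (n.-1 - m)) A.
  by rewrite mxE (unsplitK (inr i)).
have Ea x : row (a x) E = row x (C *m W).
  apply/rowP => k; rewrite 3!mxE [RHS]mxE; case: (split_ordP x) => i ->.
    rewrite al JI1 (exp_neg _ _ (a1_part i)).
    rewrite power_expansion_neg //; apply: eq_bigr => m _; rewrite Cl mxE //.
  rewrite ar JI2 (exp_pos _ _ (a2_part i) (ltn_ord _)).
  by rewrite power_expansion_pos //; apply: eq_bigr => m _; rewrite Cr mxE.
have El l : l \notin codom a -> row l E = row (s l) W.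
  move=> l_a; apply/rowP => k; rewrite !mxE.
  case: (split_ordP l) l_a => i -> l_a.
    have [lt_ir|] := ltnP i r1.
      case/codomP: l_a; exists (lshift r2 (rev_ord (Ordinal lt_ir))).
      by rewrite al; congr lshift; apply: val_inj; rewrite /= subnSK // subKn // ltnW.
    rewrite /r1 leqNgt ltn_frob_rank // -leqNgt => le_i.
    by rewrite JI1 sl /= s1E ltnNge le_i /= exprnP exp_mid1.
  (* Nonnegative positions are counted from the last one, as the parts are. *)
  rewrite -[i]rev_ordK in l_a *; move: (rev_ord i) l_a => {}i l_a.
  have [lt_ir|] := ltnP i r2.
    case/codomP: l_a; exists (rshift r1 (Ordinal lt_ir)).
    by rewrite ar; congr (rshift _ (rev_ord _)); apply: val_inj.
  rewrite /r2 leqNgt ltn_frob_rank // -leqNgt => le_i.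
  by rewrite JI2 sr s2'E /= s2E ltnNge le_i /= exprnP exp_mid2.
rewrite (det_replace_rows a_inj Ea El) mulfK ?det_power_neq0 //.
pose y (x : 'I_(r1 + r2)) : K := if split x is inl _ then 1 else (-1) ^+ n.-1.
have yl i : y (lshift r2 i) = 1 by rewrite /y (unsplitK (inl i)).
have yr i : y (rshift r1 i) = (-1) ^+ n.-1 by rewrite /y (unsplitK (inr i)).
(* The coordinates carry the sign of the column index m on the left blocks and of
   n - 1 - m on the right ones: up to the sign of n - 1 on the columns of the
   right blocks, this is one sign per row. *)
rewrite -det_tr.
have -> : (\matrix_(i, j) C i (s (a j)))^T =
    \matrix_(i, j) ((-1) ^+ s (a i) * T i j * y j).
  apply/matrixP => i j; rewrite mxE mxE [RHS]mxE /T.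
  case: (split_ordP i) => i' ->; case: (split_ordP j) => j' ->.
  - by rewrite block_mxEul mxE Cl yl mulr1 sal.
  - rewrite block_mxEur mxE Cr yr sign_sub // mulrAC; congr (_ * _ * _).
    by rewrite sal nE.
  - by rewrite block_mxEdl mxE Cl yl mulr1 sar.
  - rewrite block_mxEdr mxE Cr yr sign_sub // mulrAC; congr (_ * _ * _).
    by rewrite sar nE subsubK.
rewrite det_scale_rows_cols mulrA -[RHS]mul1r; congr (_ * _).
rewrite !big_split_ord /= [\prod_i y (lshift r2 i)]big1 ?mul1r; last first.
  by move=> i _; rewrite yl.
transitivity (((-1) ^+ s * \prod_i (-1) ^+ beta i) * \prod_i (-1) ^+ delta i : K).
  rewrite -!mulrA; congr (_ * _); congr (_ * _).
    by apply: eq_bigr => i _; rewrite sal.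
  rewrite -big_split; apply: eq_bigr => i _ /=.
  rewrite yr sar -nE (sign_sub _ (le_un _ (lt_delta i))).
  by rewrite -mulrA -expr2 sqrr_sign mulr1.
rewrite !prodrXr s_odd s1_odd s2'_odd s2_odd signr_addb !signr_odd.
rewrite (reindex_inj rev_ord_inj) mulrAC /=.
by rewrite -mulrA [X in _ * X]mulrC -expr2 exprMn !sqrr_sign mulr1.
Qed.

End Blocks.

(** * The two partitions of an exponent vector *)

Section Partitions.

Variables (t u : nat) (J : 'I_(t + u) -> int) (j : nat -> int).
Hypothesis Jj : forall l, J l = j l.
Hypothesis j_incr : forall k l, (k <= l < t + u)%N -> j k <= j l.
Hypothesis j_neg : forall l, (l < t + u)%N -> (j l < 0) = (l < t)%N.

Lemma neg_partitionE : neg_partition J = rev [seq `|j l|%N | l <- iota 0 t].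
Proof.
rewrite /neg_partition -[iota 0 t]filter_predT; congr rev.
have -> : [seq `|J l|%N | l <- enum 'I_(t + u) & J l < 0] =
    [seq `|j l|%N | l <- [seq l <- iota 0 (t + u) | j l < 0]].
  rewrite -val_enum_ord filter_map -map_comp.
  rewrite (eq_filter (a2 := fun l : 'I__ => j l < 0)) => [|l]; last by rewrite Jj.
  by apply: eq_map => l /=; rewrite Jj.
rewrite iotaD filter_cat map_cat [X in _ ++ X](_ : _ = [::]) ?cats0.
  congr map; apply: eq_in_filter => l; rewrite mem_iota => /andP[_ lt_l].
  by rewrite j_neg ?lt_l //; lia.
apply/eqP; rewrite -size_eq0 size_map size_filter -leqn0 leqNgt -has_count.
apply/hasPn => l; rewrite mem_iota => /andP[le_l lt_l].
by rewrite j_neg // -leqNgt.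
Qed.

Lemma nonneg_partitionE : nonneg_partition J = [seq `|j l|%N | l <- iota t u].
Proof.
rewrite /nonneg_partition -[iota t u]filter_predT.
have -> : [seq `|J l|%N | l <- enum 'I_(t + u) & 0 <= J l] =
    [seq `|j l|%N | l <- [seq l <- iota 0 (t + u) | 0 <= j l]].
  rewrite -val_enum_ord filter_map -map_comp.
  rewrite (eq_filter (a2 := fun l : 'I__ => 0 <= j l)) => [|l]; last by rewrite Jj.
  by apply: eq_map => l /=; rewrite Jj.
rewrite iotaD filter_cat map_cat [X in X ++ _](_ : _ = [::]) ?cat0s.
  congr map; apply: eq_in_filter => l; rewrite mem_iota => /andP[le_l lt_l].
  by rewrite leNgt j_neg // ltnNge le_l.
apply/eqP; rewrite -size_eq0 size_map size_filter -leqn0 leqNgt -has_count.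
apply/hasPn => l; rewrite mem_iota => /andP[_ lt_l].
by rewrite leNgt j_neg ?lt_l //; lia.
Qed.

Lemma size_neg_partition : size (neg_partition J) = t.
Proof. by rewrite neg_partitionE size_rev size_map size_iota. Qed.

Lemma size_nonneg_partition : size (nonneg_partition J) = u.
Proof. by rewrite nonneg_partitionE size_map size_iota. Qed.

Lemma part_neg_partition l : (l < t)%N -> j l = - (part (neg_partition J) l)%:Z.
Proof.
move=> lt_lt; rewrite /part neg_partitionE revK (nth_map 0%N) ?size_iota //.
rewrite nth_iota // add0n; have := j_neg (ltn_addr u lt_lt); rewrite lt_lt; lia.
Qed.

Lemma part_nonneg_partition l : (l < u)%N ->
  j (t + (u - l.+1))%N = (part (nonneg_partition J) l)%:Z.
Proof.
move=> lt_lu; rewrite /part nth_rev ?size_nonneg_partition // nonneg_partitionE.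
rewrite (nth_map 0%N) ?size_iota; last lia.
rewrite nth_iota; last lia.
have := @j_neg (t + (u - l.+1)); lia.
Qed.

Lemma sorted_neg_partition : sorted leq (neg_partition J).
Proof.
rewrite neg_partitionE rev_sorted; apply/(sortedP 0%N) => l.
rewrite size_map size_iota => lt_lt; rewrite !(nth_map 0%N) ?size_iota; try lia.
rewrite !nth_iota; try lia.
rewrite /= !add0n; have := @j_incr l l.+1; have := @j_neg l.+1; lia.
Qed.

Lemma sorted_nonneg_partition : sorted leq (nonneg_partition J).
Proof.
rewrite nonneg_partitionE; apply/(sortedP 0%N) => l.
rewrite size_map size_iota => lt_lt; rewrite !(nth_map 0%N) ?size_iota; try lia.
rewrite !nth_iota; try lia.
have := @j_incr (t + l) (t + l.+1); have := @j_neg (t + l); lia.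
Qed.

End Partitions.

Theorem theorem3p5 (K : fieldType) (n : nat) (A : 'I_n -> K) (J : 'I_n -> int)
    (n_gt0 : (0 < n)%N)
    (A_inj : injective A)
    (A_neq0 : forall k : 'I_n, A k != 0)
    (J_incr : forall k l : 'I_n, (k <= l)%N -> J k <= J l) :
  let A_vee := fun k : 'I_n => (A k)^-1 in
  let I1 := neg_partition J in
  let I2 := nonneg_partition J in
  let r1 := frob_rank I1 in
  let r2 := frob_rank I2 in
  let alpha := frob_arm I1 in
  let beta := frob_leg I1 in
  let gamma := frob_arm I2 in
  let delta := frob_leg I2 in
  let P := \matrix_(i < r1, j < r1)
             schur (hook (alpha (rev_ord j)) (beta (rev_ord i))) A_vee in
  let Q := \matrix_(i < r1, j < r2)
             schur (hook (gamma j) (n - 1 - beta (rev_ord i))) A in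
  let M := \matrix_(i < r2, j < r1)
             schur (hook (alpha (rev_ord j)) (n - 1 - delta i)) A_vee in
  let N := \matrix_(i < r2, j < r2)
             schur (hook (gamma j) (delta i)) A in
  alternant J A = \det (block_mx P Q M N).
Proof.
pose j (l : nat) : int := J (insubd (Ordinal n_gt0) l).
have Jj : J =1 (fun l => j l) by move=> l; rewrite /j valKd.
have j_incr k l : (k <= l < n)%N -> j k <= j l.
  case/andP=> le_kl lt_ln; apply: J_incr.
  by rewrite !val_insubd lt_ln (leq_ltn_trans le_kl).
have [t [u [def_n j_neg]]] : exists t u,
    n = (t + u)%N /\ forall l, (l < n)%N -> (j l < 0) = (l < t)%N.
  pose P l := (l < n)%N && (j l < 0).
  exists (count P (iota 0 n)), (n - count P (iota 0 n))%N.
  have le_tn : (count P (iota 0 n) <= n)%N.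
    by rewrite -[X in (_ <= X)%N](size_iota 0) count_size.
  split=> [|l lt_ln]; first by rewrite subnKC.
  rewrite count_downset ?lt_ln /P ?lt_ln // => k m le_km /andP[lt_mn j_m].
  rewrite (leq_ltn_trans le_km) //=; apply: le_lt_trans j_m.
  by rewrite j_incr // le_km.
clearbody j; clear J_incr; subst n.
apply: alternant_block_hooks => //.
- exact: size_neg_partition Jj j_neg.
- exact: size_nonneg_partition Jj j_neg.
- exact: sorted_neg_partition Jj j_incr j_neg.
- exact: sorted_nonneg_partition Jj j_incr j_neg.
- by move=> l; rewrite Jj /= -(part_neg_partition Jj j_neg).
- by move=> l; rewrite Jj /= -(part_nonneg_partition Jj j_neg).
Qed.
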